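(* For all integers $t \geq k \geq 2$, there exists a bipartite graph that is not $(k,t)$-choosable.
   Context: Graphs are finite and simple. For integers $t \geq k$, a $(k,t)$-list assignment of a graph $G$ (union separation) is a function $L$ assigning to each vertex $v$ a set $L(v)$ of colors such that $|L(v)| \geq k$ for all vertices $v$ and $|L(u)\cup L(v)| \geq t$ for all edges $uv$. An $L$-coloring is an assignment $c$ of colors to the vertices with $c(v) \in L(v)$ for all vertices $v$ and $c(u)\neq c(v)$ for all adjacent $u,v$. A graph is $(k,t)$-choosable if it has an $L$-coloring for every $(k,t)$-list assignment $L$. *)

(* Defs.v *)
From mathcomp Require Import all_boot.
Set Implicit Arguments.
Unset Strict Implicit.
Unset Printing Implicit Defensive.

Record sgraph := SGraph {
  vertex : finType;
  edge : rel vertex;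
  edge_sym : symmetric edge;
  edge_irrefl : irreflexive edge }.

Definition bipartite (G : sgraph) : Prop :=
  exists A : {set vertex G},
    forall u v : vertex G, edge u v -> (u \in A) != (v \in A).

Definition kt_list_assignment (k t : nat) (G : sgraph) (C : finType)
    (L : vertex G -> {set C}) : Prop :=
  (forall v : vertex G, k <= #|L v|) /\
  (forall u v : vertex G, edge u v -> t <= #|L u :|: L v|).

Definition list_coloring (G : sgraph) (C : finType)
    (L : vertex G -> {set C}) (c : vertex G -> C) : Prop :=
  (forall v : vertex G, c v \in L v) /\
  (forall u v : vertex G, edge u v -> c u <> c v).

(* Lists are finite and G has finitely many vertices, so letting C range over
   all finite types of colours covers every list assignment. *)
Definition kt_choosable (k t : nat) (G : sgraph) : Prop :=
  forall (C : finType) (L : vertex G -> {set C}),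
    kt_list_assignment k t L -> exists c : vertex G -> C, list_coloring L c.

(* Main.v *)
(* Give the k vertices of one side of K_{k,t^k} pairwise disjoint lists of size
   t: then every edge has union of size at least t. The vertices of the other
   side have as lists the t^k transversals of these k lists; whatever colours
   the first side uses form one of those transversals, and its vertex cannot
   be coloured. *)
Require Import Defs.
From mathcomp Require Import all_boot.

Definition transversal_edge (k t : nat)
    (u v : 'I_k + {ffun 'I_k -> 'I_t}) : bool :=
  match u, v with
  | inl _, inr _ | inr _, inl _ => true
  | _, _ => false
  end.

Lemma transversal_edge_sym (k t : nat) : symmetric (transversal_edge k t).
Proof. by case=> [i|f] [j|g]. Qed.

Lemma transversal_edge_irrefl (k t : nat) :
  irreflexive (transversal_edge k t).
Proof. by case. Qed.

Definition transversal_graph (k t : nat) : sgraph :=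
  SGraph (transversal_edge_sym k t) (transversal_edge_irrefl k t).

(** Tagging each colour with an index in ['I_k] makes the lists on the [inl] side disjoint by
    construction; their transversals are then exactly the graphs of functions from ['I_k] to
    ['I_t]. *)
Definition transversal_list (k t : nat)
    (v : 'I_k + {ffun 'I_k -> 'I_t}) : {set 'I_k * 'I_t} :=
  match v with
  | inl i => [set (i, c) | c in 'I_t]
  | inr f => [set (i, f i) | i in 'I_k]
  end.

Lemma card_transversal_list_inl (k t : nat) (i : 'I_k) :
  #|transversal_list k t (inl i)| = t.
Proof. by rewrite card_imset ?card_ord // => c d []. Qed.

Lemma card_transversal_list_inr (k t : nat) (f : {ffun 'I_k -> 'I_t}) :
  #|transversal_list k t (inr f)| = k.
Proof. by rewrite card_imset ?card_ord // => i j []. Qed.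

Lemma transversal_graph_bipartite (k t : nat) :
  bipartite (transversal_graph k t).
Proof.
exists [set v : 'I_k + {ffun 'I_k -> 'I_t} | if v is inl _ then true else false].
by case=> [i|f] [j|g] //= _; rewrite !inE.
Qed.

(** Each edge has an [inl] endpoint, whose list alone already provides [t] colours. *)
Lemma transversal_list_assignment (k t : nat) : k <= t ->
  @kt_list_assignment k t (transversal_graph k t) _ (transversal_list k t).
Proof.
move=> le_kt; split=> [[i|f]|[i|f] [j|g]] //=.
- by rewrite (card_transversal_list_inl k t i).
- by rewrite (card_transversal_list_inr k t f).
- by move=> _; rewrite -{1}(card_transversal_list_inl k t i) subset_leq_card ?subsetUl.
- by move=> _; rewrite -{1}(card_transversal_list_inl k t j) subset_leq_card ?subsetUr.
Qed.

Lemma transversal_list_not_colorable (k t : nat)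
    (c : 'I_k + {ffun 'I_k -> 'I_t} -> 'I_k * 'I_t) :
  ~ @list_coloring (transversal_graph k t) _ (transversal_list k t) c.
Proof.
case=> cL c_proper; pose f := [ffun i => (c (inl i)).2].
have /imsetP[i _ cf] := cL (inr f).
(* The colour of [inr f] is [(i, f i)]. It equals that of [inl i]: the second coordinates agree by
   the choice of [f], and every colour in the list of [inl i] has tag [i]. *)
apply: (c_proper (inl i) (inr f)) => //; rewrite cf ffunE.
by have /imsetP[d _ ->] := cL (inl i).
Qed.

Theorem proposition3 (k t : nat) (hk : 2 <= k) (hkt : k <= t) :
  exists G : sgraph, bipartite G /\ ~ kt_choosable k t G.
Proof.
exists (transversal_graph k t); split; first exact: transversal_graph_bipartite.
move=> /(_ _ _ (transversal_list_assignment k t hkt))[c].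
exact: transversal_list_not_colorable.
Qed.
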